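(* Under the standing assumptions (A1)–(A5) listed in the context, there exist $\underline{\alpha}_Y\in\mathcal{K}_\infty$ and $\overline{\alpha}_Y,\alpha_Y:\mathbb{R}_{\ge0}\times(\gamma^\star,\gamma_0)\to\mathbb{R}_{\ge0}$ of class $\mathcal{K}_\infty$ in their first argument such that for any $i\in\mathbb{Z}_{\ge0}$ there exist $Y^i_\gamma:\mathbb{R}^{n_x}\to\mathbb{R}_{\ge0}$ and $\Upsilon^i:\mathbb{R}_{\ge0}\times(\gamma^\star,\gamma_0)\to\mathbb{R}_{\ge0}$ of class $\mathcal{K}_\infty$ in its first argument such that the following holds for any $\gamma\in(\gamma^\star,\gamma_0)$. (i) For any $x\in\mathbb{R}^{n_x}$, $\underline{\alpha}_Y(\sigma(x))\le Y^i_\gamma(x)\le\overline{\alpha}_Y(\sigma(x),\gamma)$. (ii) For any $x\in\mathbb{R}^{n_x}$ and $v\in F^i_\gamma(x)$, $$Y^i_\gamma(v)-Y^i_\gamma(x)\le\tfrac1\gamma\Big(-\alpha_Y(\sigma(x),\gamma)+\Upsilon^i(\sigma(x),\gamma)\Big).$$ Here the functions are given explicitly by $\underline{\alpha}_Y=\alpha_W$, $\alpha_Y(\cdot,\gamma)=\tfrac{\gamma-\gamma^\star}{1-\gamma^\star}\alpha_W$, $\overline{\alpha}_Y(\cdot,\gamma)=\overline{\alpha}_V(\cdot,\gamma)+\tfrac1\gamma\overline{\alpha}_W$, $Y^i_\gamma=V^i_\gamma+\tfrac1\gamma W$ and $\Upsilon^i(s,\gamma)=(1-\gamma)\gamma^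i\,\overline{\alpha}_V\big(\beta^\star_\gamma(s,i),\gamma\big)$.
   Context: **Comparison functions.** $\mathcal{K}_\infty$: continuous, strictly increasing, unbounded functions $\mathbb{R}_{\ge 0}\to\mathbb{R}_{\ge 0}$ that are zero at zero. $\mathcal{KL}$: functions $\beta(s,k)\ge 0$ nondecreasing in $s$, nonincreasing in $k$, with $\lim_{s\to 0^+}\beta(s,k)=0$ for each $k$ and $\lim_{k\to\infty}\beta(s,k)=0$ for each $s$. $\mathbb{I}$ is the identity on $\mathbb{R}_{\ge 0}$; $g^{(k)}$ is the $k$-fold composition of $g$, with $g^{(0)}=\mathbb{I}$. **System and cost.** $x(k+1)=f(x(k),u(k))$, $k\in\mathbb{Z}_{\ge 0}$, with state $x\in\mathbb{R}^{n_x}$ and input $u\in\mathcal{U}(x)\subseteq\mathbb{R}^{n_u}$, $\mathcal{U}(x)\neq\emptyset$ being the set of admissible inputs at $x$; a policy $h:\mathbb{R}^{n_x}\to\mathbb{R}^{n_u}$ is admissible ($h\in\mathcal{U}$) if $h(x)\in\mathcal{U}(x)$ for all $x$. For a stage cost $\ell:\mathbb{R}^{n_x}\times\mathbb{R}^{n_u}\to\mathbb{R}_{\ge0}$ and $\gamma\in(0,1)$, $J_\gamma(x,\boldsymbol{u})=\sum_{k=0}^\infty\gamma^k\ell(\phi(k,x,\boldsymbol{u}|_k),u(k))$, where $\phi(k,x,\boldsymbol{u}|_k)$ is the solution at time $k$ from $x$ under the admissible input sequence $\boldsymbol{u}$; $J_\gamma(x,h)$ is the cost when the inputs are generated by the feedback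 $h$. $V^\star_\gamma(x)=\min_{\boldsymbol{u}}J_\gamma(x,\boldsymbol{u})$, $H^\star_\gamma(x)=\operatorname{argmin}_{u\in\mathcal{U}(x)}\{\ell(x,u)+\gamma V^\star_\gamma(f(x,u))\}$ and $F^\star_\gamma(x)=f(x,H^\star_\gamma(x))$. **Policy iteration (PI).** Given $\gamma$ and an admissible initial policy $h^0$: $V^0_\gamma(x)=J_\gamma(x,h^0)$; for $i\in\mathbb{Z}_{\ge0}$, $H^{i+1}_\gamma(x)=\operatorname{argmin}_{u\in\mathcal{U}(x)}\{\ell(x,u)+\gamma V^i_\gamma(f(x,u))\}$, an arbitrary selection $h^{i+1}_\gamma\in H^{i+1}_\gamma$ is chosen (i.e. $h^{i+1}_\gamma(x)\in H^{i+1}_\gamma(x)$ for all $x$), and $V^{i+1}_\gamma(x)=J_\gamma(x,h^{i+1}_\gamma)$. Set $H^0_\gamma(x)=\{h^0(x)\}$ and $F^i_\gamma(x)=f(x,H^i_\gamma(x))$ for $i\in\mathbb{Z}_{\ge0}$. **State measure.** $\sigma:\mathbb{R}^{n_x}\to\mathbb{R}_{\ge0}$ is continuous and radially unbounded ($\{x:\sigma(x)\le\Delta\}$ is compact for every $\Delta>0$); it vanishes on the attractor of interest. **Standing assumptions.** (A1) For every $x\in\mathbb{R}^{n_x}$ and $\gamma\in(0,1)$ there is an admissible input sequence attaining the minimum $V^\star_\gamma(x)<+\infty$. (A2) $H^i_\gamma(x)\ne\emptyset$ for all $i\in\mathbb{Z}_{>0}$, $x\in\mathbb{R}^{n_x}$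 (for the discount factors $\gamma$ considered). (A3) There exist a continuous $W:\mathbb{R}^{n_x}\to\mathbb{R}_{\ge0}$, $\alpha_W\in\mathcal{K}_\infty$ and a continuous, nondecreasing $\overline{\alpha}_W:\mathbb{R}_{\ge0}\to\mathbb{R}_{\ge0}$, zero at zero, such that for all $x\in\mathbb{R}^{n_x}$, $u\in\mathcal{U}(x)$: $W(x)\le\overline{\alpha}_W(\sigma(x))$ and $W(f(x,u))-W(x)\le-\alpha_W(\sigma(x))+\ell(x,u)$. (A4) There exist $\gamma_0\in(0,1]$ and $\overline{\alpha}_V:\mathbb{R}_{\ge0}\times(0,\gamma_0)\to\mathbb{R}_{\ge0}$, of class $\mathcal{K}_\infty$ in its first argument, such that $V^0_\gamma(x)=J_\gamma(x,h^0)\le\overline{\alpha}_V(\sigma(x),\gamma)$ for all $x\in\mathbb{R}^{n_x}$, $\gamma\in(0,\gamma_0)$. (A5) (i) There is $\overline{\alpha}_{V^\star}\in\mathcal{K}_\infty$ with $V^\star_\gamma(x)\le\overline{\alpha}_{V^\star}(\sigma(x))$ for all $x\in\mathbb{R}^{n_x}$, $\gamma\in(0,\gamma_0)$. (ii) There is $\gamma^\star\in(0,\gamma_0)$ with $(1-\gamma^\star)\overline{\alpha}_{V^\star}(s)\le\alpha_W(s)$ for all $s>0$. **The function $\beta^\star_\gamma$.** For $\gamma\in(\gamma^\star,\gamma_0)$ let $\overline{\alpha}_{Y^\star}=\overline{\alpha}_{V^\star}+\tfrac1{\gamma^\star}\overline{\alpha}_W$, $\alpha_{Y^\star}(\cdot,\gamma)=\tfrac{\gamma-\gamma^\star}{1-\gamma^\star}\alpha_W$,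 $\widetilde\alpha_{Y^\star}(\cdot,\gamma)=\alpha_{Y^\star}(\overline{\alpha}_{Y^\star}^{-1}(\cdot),\gamma)$, $\widetilde\beta^\star_\gamma(s,k)=\max_{\hat s\in[0,s]}\big(\mathbb{I}-\tfrac1\gamma\widetilde\alpha_{Y^\star}(\cdot,\gamma)\big)^{(k)}(\hat s)$, and $\beta^\star_\gamma(s,k)=\alpha_W^{-1}\big(\widetilde\beta^\star_\gamma(\overline{\alpha}_{Y^\star}(s),k)\big)$. This is a $\mathcal{KL}$ function such that every solution of $x(k+1)\in F^\star_\gamma(x(k))$ from $x$ satisfies $\sigma(\phi^\star_\gamma(k,x))\le\beta^\star_\gamma(\sigma(x),k)$ for all $k\in\mathbb{Z}_{\ge0}$.
   Formalization: The explicit Υ^i need not be strictly increasing, and (ii) with it can fail for greedy inputs other than h^i_γ(x). Instead some K∞ Υ^i ≥ the formula gives (ii) on all F^i_γ(x); the formula is shown continuous, nondecreasing, unbounded, zero at 0, with (ii) for v=f(x,h^i_γ(x)). *)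

(* Defs.v *)
From HB Require Import structures.
From mathcomp Require Import all_boot all_order all_algebra.
From mathcomp Require Import all_classical all_reals all_analysis.

Set Implicit Arguments.
Unset Strict Implicit.
Unset Printing Implicit Defensive.

Import Order.TTheory GRing.Theory Num.Theory.
Import numFieldNormedType.Exports.

Local Open Scope classical_set_scope.
Local Open Scope ring_scope.

(** Functions on the nonnegative reals are represented by functions [R -> R]
    of which only the restriction to [`[0, +oo[] matters. *)

Section Comparison.
Context {R : realType}.
Implicit Types a : R -> R.

Definition zero_at_zero a := a 0 = 0.

Definition continuous_nneg a := {within `[0, +oo[, continuous a}.

Definition nondecreasing_nneg a :=
  forall s t, 0 <= s -> s <= t -> a s <= a t.

Definition increasing_nneg a :=
  forall s t, 0 <= s -> s < t -> a s < a t.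

Definition unbounded_nneg a := forall M, exists2 s, 0 <= s & M < a s.

Definition class_Kinf a :=
  [/\ zero_at_zero a, continuous_nneg a, increasing_nneg a
    & unbounded_nneg a].

(** For [a] of class K-infinity and [0 <= y], the [s >= 0] with [a s = y]. *)
Definition Kinf_inv a : R -> R := 'pinv_(fun=> 0) `[0, +oo[ a.

End Comparison.

Section Control.
Context {R : realType} {nx nu : nat}.
Local Notation X := 'rV[R]_nx.
Local Notation U := 'rV[R]_nu.
Variables (f : X -> U -> X) (Uad : X -> set U) (l : X -> U -> R).

Fixpoint phi (x : X) (u : nat -> U) (k : nat) : X :=
  if k is k'.+1 then f (phi x u k') (u k') else x.

Definition admissible_seq (x : X) (u : nat -> U) :=
  forall k, Uad (phi x u k) (u k).

Definition admissible_policy (h : X -> U) := forall x, Uad x (h x).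

(** A series of nonnegative terms, hence possibly [+oo]. *)
Definition J (g : R) (x : X) (u : nat -> U) : \bar R :=
  (\sum_(0 <= k <oo) (g ^+ k * l (phi x u k) (u k))%:E)%E.

Definition policy_inputs (h : X -> U) (x : X) : nat -> U :=
  fun k => h (iter k (fun z => f z (h z)) x).

Definition Jpol (g : R) (x : X) (h : X -> U) : \bar R :=
  J g x (policy_inputs h x).

Definition is_optimal_seq (g : R) (x : X) (u : nat -> U) :=
  admissible_seq x u /\ forall w, admissible_seq x w -> (J g x u <= J g x w)%E.

(** The minimum of the cost; attained as soon as some [u] satisfies
    [is_optimal_seq g x u]. *)
Definition Vstar (g : R) (x : X) : \bar R :=
  ereal_inf [set J g x u | u in admissible_seq x].

Definition argmin_set (A : set U) (F : U -> \bar R) : set U :=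
  [set u | A u /\ forall w, A w -> (F u <= F w)%E].

(** Below, [h i] is the policy selected at iteration [i] for the discount
    factor [g]; [Vpi], [Hpi] and [Fpi] are the value function, the set of
    greedy inputs and the closed-loop map at iteration [i]. *)

Definition Vpi (g : R) (h : nat -> X -> U) (i : nat) (x : X) : \bar R :=
  Jpol g x (h i).

Definition Hpi (g : R) (h : nat -> X -> U) (i : nat) (x : X) : set U :=
  if i is j.+1 then
    argmin_set (Uad x) (fun u => (l x u)%:E + g%:E * Vpi g h j (f x u))%E
  else [set h 0 x].

Definition Fpi (g : R) (h : nat -> X -> U) (i : nat) (x : X) : set X :=
  [set f x u | u in Hpi g h i x].

Definition is_policy_iteration (g : R) (h0 : X -> U) (h : nat -> X -> U) :=
  h 0 = h0 /\ forall i x, Hpi g h i.+1 x (h i.+1 x).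

End Control.

Section BetaStar.
Context {R : realType}.
(** [aVs], [aWbar], [aW] are the bounds on the optimal value function, on the
    detectability function [W], and on its decrease. *)
Variables (aVs aWbar aW : R -> R) (gs : R).

Definition aYsbar (s : R) : R := aVs s + gs^-1 * aWbar s.

Definition aYs (s g : R) : R := (g - gs) / (1 - gs) * aW s.

Definition aYs_tilde (s g : R) : R := aYs (Kinf_inv aYsbar s) g.

(** The supremum is a maximum when the iterated map is continuous. *)
Definition beta_tilde (g s : R) (k : nat) : R :=
  sup [set iter k (fun r => r - g^-1 * aYs_tilde r g) t | t in `[0, s]].

Definition beta_star (g s : R) (k : nat) : R :=
  Kinf_inv aW (beta_tilde g (aYsbar s) k).

(** Continuous and nondecreasing in [s], but in general not strictly increasing
    for [0 < i]: the running maximum in [beta_tilde] can have plateaus. *)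
Definition Upsilon_star (aV : R -> R -> R) (i : nat) (s g : R) : R :=
  (1 - g) * g ^+ i * aV (beta_star g s i) g.

End BetaStar.

(* Main.v *)
(** Along an input in the greedy set, the dissipation inequality for [W] turns
    the increment of [Y = V^i + W / g] into a multiple of the excess
    [V^i - V^*], plus a term [(1 - g) V^*] that (A5) lets [aW] absorb.
    Comparing [i] policy iterations with the rollout that follows an optimal
    input sequence for [i] steps and then applies the initial policy bounds
    this excess at [x] by [g ^ i * V^0] at the [i]-th point of the optimal
    trajectory, a point whose measure is at most [beta_star].

    For a greedy input other than the selected one, [V^i] is only controlled
    through [V^(i-1)]; this loses the factor [1 - g] of [Upsilon_star], whence
    the larger [Ups] for the whole set [F^i].

    That [Upsilon_star] is unbounded requires [aW <= aYsbar] at every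
    [s >= 0]. This holds at the values of [sigma], which fill the positive
    half-line: [sigma] is radially unbounded, and its infimum is [0] since
    otherwise [V^* + W / g] would decrease forever along an optimal
    trajectory. *)

Require Import Defs.
From HB Require Import structures.
From mathcomp Require Import all_boot all_order all_algebra.
From mathcomp Require Import all_classical all_reals all_analysis.
From mathcomp Require Import lra.

Set Implicit Arguments.
Unset Strict Implicit.
Unset Printing Implicit Defensive.

Import Order.TTheory GRing.Theory Num.Theory.
Import numFieldNormedType.Exports.

Local Open Scope classical_set_scope.
Local Open Scope ring_scope.

(** * Comparison functions on the nonnegative half-line *)

Section ComparisonFunctions.
Context {R : realType}.
Implicit Types a b : R -> R.

Lemma continuous_nnegP a : continuous_nneg a <->
  forall s e, 0 <= s -> 0 < e ->
    exists2 d, 0 < d & forall t, 0 <= t -> `|t - s| < d -> `|a t - a s| < e.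
Proof.
rewrite /continuous_nneg; split.
- move=> /subspace_continuousP ca s e s0 e0.
  have sI : [set` `[0, +oo[] s by rewrite /= in_itv /= s0.
  have /cvgrPdist_lt /(_ e e0) := ca s sI.
  rewrite near_withinE => -[d /= d0 dP]; exists d => // t t0 td.
  rewrite distrC; apply: dP => /=; first by rewrite distrC.
  by rewrite in_itv /= t0.
- move=> H; apply/subspace_continuousP => s; rewrite /= in_itv /= andbT => s0.
  apply/cvgrPdist_lt => e e0; rewrite near_withinE.
  have [d d0 dP] := H s e s0 e0; exists d => //= t td.
  by rewrite in_itv /= andbT => t0; rewrite distrC; apply: dP; rewrite // distrC.
Qed.

Lemma continuous_nneg_itv a x y : 0 <= x -> continuous_nneg a ->
  {within `[x, y], continuous a}.
Proof.
move=> x0; apply: continuous_subspaceW => t /=.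
by rewrite !in_itv /= andbT => /andP[+ _]; apply: le_trans.
Qed.

Lemma continuous_nneg_IVT a s y : continuous_nneg a -> 0 <= s ->
  a 0 <= y <= a s -> exists2 t, 0 <= t <= s & a t = y.
Proof.
move=> ca s0 /andP[ya ys].
have [|c cI <-] := IVT s0 (continuous_nneg_itv (lexx 0) ca) (v := y).
- by rewrite ge_min le_max ya ys orbT.
- by exists c => //; move: cI; rewrite in_itv.
Qed.

Lemma continuous_nneg_comp a b : continuous_nneg a -> continuous_nneg b ->
  (forall s, 0 <= s -> 0 <= b s) -> continuous_nneg (a \o b).
Proof.
move=> /continuous_nnegP ca /continuous_nnegP cb b0.
apply/continuous_nnegP => s e s0 e0.
have [d d0 dP] := ca (b s) e (b0 _ s0) e0.
have [c c0 cP] := cb s d s0 d0.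
by exists c => // t t0 tc; apply: dP; [exact: b0 | exact: cP].
Qed.

Lemma continuous_nnegD a b : continuous_nneg a -> continuous_nneg b ->
  continuous_nneg (fun s => a s + b s).
Proof. by move=> ca cb x; apply: cvgD; [exact: ca | exact: cb]. Qed.

Lemma continuous_nnegZ c a : continuous_nneg a ->
  continuous_nneg (fun s => c * a s).
Proof. by move=> ca x; apply: cvgMr; exact: ca. Qed.

Lemma continuous_nneg_id : continuous_nneg (fun s : R => s).
Proof. by apply/continuous_nnegP => s e s0 e0; exists e. Qed.

(* Stability under [sup] of images is what makes the weaker, nondecreasing
   class the right one for [Upsilon_star]. *)
Definition nondecreasing_class a :=
  [/\ zero_at_zero a, continuous_nneg a, nondecreasing_nneg a
    & unbounded_nneg a].

Lemma class_Kinf_nondecreasing a : class_Kinf a -> nondecreasing_class a.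
Proof.
move=> [a0 ca ia ua]; split=> // s t s0.
by rewrite le_eqVlt => /predU1P[-> //|st]; apply/ltW/ia.
Qed.

Lemma nondecreasing_class_ge0 a s : nondecreasing_class a -> 0 <= s -> 0 <= a s.
Proof. by move=> [a0 _ na _] s0; rewrite -a0; exact: na. Qed.

Lemma class_Kinf_ge0 a s : class_Kinf a -> 0 <= s -> 0 <= a s.
Proof. by move=> /class_Kinf_nondecreasing; exact: nondecreasing_class_ge0. Qed.

Lemma class_Kinf_le a s t : class_Kinf a -> 0 <= s -> s <= t -> a s <= a t.
Proof. by move=> /class_Kinf_nondecreasing[_ _ na _]; exact: na. Qed.

Lemma class_Kinf_le_cancel a s t :
  class_Kinf a -> 0 <= t -> a s <= a t -> s <= t.
Proof.
move=> [_ _ ia _] t0; apply: contraTT; rewrite -!ltNge; exact: ia.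
Qed.

Lemma nondecreasing_class_comp a b : nondecreasing_class a ->
  nondecreasing_class b -> nondecreasing_class (a \o b).
Proof.
move=> [a0 ca na ua] bP; have b_ge0 s := nondecreasing_class_ge0 (s := s) bP.
have [b0 cb nb ub] := bP; split.
- by rewrite /zero_at_zero /= b0.
- exact: continuous_nneg_comp.
- by move=> s t s0 st; apply: na; [exact: b_ge0 | exact: nb].
- move=> M; have [u u0 Mu] := ua M; have [s s0 us] := ub u.
  by exists s => //=; apply: lt_le_trans Mu _; apply: na => //; exact: ltW.
Qed.

Lemma nondecreasing_classZ c a : 0 < c -> nondecreasing_class a ->
  nondecreasing_class (fun s => c * a s).
Proof.
move=> c0 [a0 ca na ua]; split.
- by rewrite /zero_at_zero a0 mulr0.
- exact: continuous_nnegZ.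
- by move=> s t s0 st; rewrite ler_pM2l//; exact: na.
- move=> M; have [s s0] := ua (M / c).
  by rewrite ltr_pdivrMr// mulrC => Ms; exists s.
Qed.

Lemma class_KinfD a b : class_Kinf a -> zero_at_zero b -> continuous_nneg b ->
  nondecreasing_nneg b -> class_Kinf (fun s => a s + b s).
Proof.
move=> [a0 ca ia ua] b0 cb nb; split.
- by rewrite /zero_at_zero a0 b0 addr0.
- exact: continuous_nnegD.
- by move=> s t s0 st; rewrite ltr_leD//; [exact: ia | apply: nb => //; exact: ltW].
- move=> M; have [s s0 Ms] := ua M; exists s => //.
  by rewrite ltr_wpDr// -b0; exact: nb.
Qed.

Lemma class_KinfZ c a : 0 < c -> class_Kinf a -> class_Kinf (fun s => c * a s).
Proof.
move=> c0 aP; have [_ _ ia _] := aP.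
have [? ? _ ?] := nondecreasing_classZ c0 (class_Kinf_nondecreasing aP).
by split=> // s t s0 st; rewrite ltr_pM2l//; exact: ia.
Qed.

Lemma class_Kinf_id : class_Kinf (fun s : R => s).
Proof.
split=> //; first exact: continuous_nneg_id.
move=> M; exists (`|M| + 1); first by rewrite addr_ge0.
by apply: le_lt_trans (ler_norm M) _; rewrite ltrDl.
Qed.

Lemma class_Kinf_surj a y : class_Kinf a -> 0 <= y -> exists2 s, 0 <= s & a s = y.
Proof.
move=> [a0 ca _ ua] y0; have [s s0 ys] := ua y.
have [|t /andP[t0 _] <-] := continuous_nneg_IVT ca s0 (y := y).
  by rewrite a0 y0 ltW.
by exists t.
Qed.

Lemma Kinf_invK a s : class_Kinf a -> 0 <= s -> Kinf_inv a (a s) = s.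
Proof.
move=> aP s0; rewrite /Kinf_inv pinvKV//; last first.
  by rewrite inE /= in_itv /= s0.
move=> u v; rewrite !inE /= !in_itv /= !andbT => u0 v0 uv.
by apply/le_anti/andP; split; apply: (class_Kinf_le_cancel aP); rewrite ?uv.
Qed.

Lemma Kinf_inv_ge0 a y : class_Kinf a -> 0 <= y -> 0 <= Kinf_inv a y.
Proof. by move=> aP /(class_Kinf_surj aP)[s s0 <-]; rewrite Kinf_invK. Qed.

Lemma Kinf_invKV a y : class_Kinf a -> 0 <= y -> a (Kinf_inv a y) = y.
Proof. by move=> aP /(class_Kinf_surj aP)[s s0 <-]; rewrite Kinf_invK. Qed.

Lemma class_Kinf_inv a : class_Kinf a -> class_Kinf (Kinf_inv a).
Proof.
move=> aP; have [a0 ca ia ua] := aP; split.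
- by rewrite /zero_at_zero -[in LHS]a0 Kinf_invK.
- apply/continuous_nnegP => y e /(class_Kinf_surj aP)[s s0 <-] e0.
  rewrite Kinf_invK//.
  have up : 0 < a (s + e) - a s by rewrite subr_gt0 ia// ltrDl.
  (* When [s < e] the bound [s - e < t] holds for every [t >= 0], so only the increment of [a] to
     the right of [s] limits the radius; [a] is never evaluated at a negative point. *)
  have [se|se] := ltP s e.
    exists (a (s + e) - a s) => // y' /(class_Kinf_surj aP)[t t0 <-].
    rewrite Kinf_invK// => /(le_lt_trans (ler_norm _)).
    rewrite ltrD2r => ate; rewrite ltr_norml; apply/andP; split; first lra.
    rewrite ltrBlDl ltNge; apply/negP => te.
    by have := class_Kinf_le aP (addr_ge0 s0 (ltW e0)) te; rewrite leNgt ate.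
  have se0 : 0 <= s - e by rewrite subr_ge0.
  have dn : 0 < a s - a (s - e) by rewrite subr_gt0 ia// gtrBl.
  exists (Num.min (a (s + e) - a s) (a s - a (s - e))).
    by rewrite lt_min up dn.
  move=> y' /(class_Kinf_surj aP)[t t0 <-]; rewrite Kinf_invK// lt_min.
  rewrite !ltr_norml => /andP[/andP[_ h1] /andP[h2 _]].
  apply/andP; split.
    rewrite ltNge; apply/negP => te.
    by have := class_Kinf_le aP t0 (_ : t <= s - e); lra.
  rewrite ltNge; apply/negP => te.
  by have := class_Kinf_le aP (addr_ge0 s0 (ltW e0)) (_ : s + e <= t); lra.
- move=> y z y0 yz; have z0 : 0 <= z := le_trans y0 (ltW yz).
  rewrite ltNge; apply/negP => /(class_Kinf_le aP (Kinf_inv_ge0 aP z0)).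
  by rewrite !Kinf_invKV// leNgt yz.
- move=> M; have M0 : 0 <= `|M| + 1 by rewrite addr_ge0.
  exists (a (`|M| + 1)); first exact: class_Kinf_ge0.
  by rewrite Kinf_invK//; apply: le_lt_trans (ler_norm M) _; rewrite ltrDl.
Qed.

Lemma running_sup_ub a s t : continuous_nneg a -> 0 <= t <= s ->
  a t <= sup [set a r | r in `[0, s]].
Proof.
move=> ca /andP[t0 ts]; have s0 := le_trans t0 ts.
have [c _ cP] := EVT_max s0 (continuous_nneg_itv (lexx 0) ca).
apply: ub_le_sup; last by exists t => //=; rewrite in_itv /= t0.
by exists (a c) => _ [r /= rI <-]; exact: cP.
Qed.

Lemma running_sup_le a s M : 0 <= s -> (forall t, 0 <= t <= s -> a t <= M) ->
  sup [set a r | r in `[0, s]] <= M.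
Proof.
move=> s0 aM; apply: ge_sup; last first.
  by move=> _ [r /= + <-]; rewrite in_itv /=; exact: aM.
by exists (a 0), 0 => //=; rewrite in_itv /= lexx.
Qed.

Lemma running_sup_class a : zero_at_zero a -> continuous_nneg a ->
  unbounded_nneg a -> nondecreasing_class (fun s => sup [set a t | t in `[0, s]]).
Proof.
move=> a0 ca ua; split.
- apply/eqP; rewrite eq_le; apply/andP; split.
    by apply: running_sup_le => // t t0; rewrite -(le_anti t0) a0.
  by rewrite -[leLHS]a0; apply: running_sup_ub; rewrite ?lexx.
- apply/continuous_nnegP => s e s0 e0.
  have [d d0 dP] := (continuous_nnegP a).1 ca s (e / 3) s0 (ltac:(lra)).
  (* Enlarging the interval from [s1] to [s2] adds only values of [a] within [e / 3] of [a s], while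
     the smaller supremum is already at least [a s1], which is also within [e / 3] of [a s]. *)
  have osc s1 s2 : 0 <= s1 -> s1 <= s2 -> `|s1 - s| < d -> `|s2 - s| < d ->
      0 <= sup [set a r | r in `[0, s2]] - sup [set a r | r in `[0, s1]]
        <= 2 * (e / 3).
    move=> s10 s12 ds1 ds2; have s20 := le_trans s10 s12.
    rewrite subr_ge0; apply/andP; split.
      apply: running_sup_le => // t /andP[t0 ts1]; apply: running_sup_ub => //.
      by rewrite t0 (le_trans ts1).
    rewrite lerBlDl; apply: running_sup_le => // t /andP[t0 ts2].
    have [ts1|ts1] := leP t s1.
      have := running_sup_ub (s := s1) (t := t) ca; rewrite t0 ts1 => /(_ isT); lra.
    have := running_sup_ub (s := s1) (t := s1) ca; rewrite s10 lexx => /(_ isT).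
    have td : `|t - s| < d.
      by move: ds1 ds2; rewrite !ltr_norml; lra.
    have := dP _ t0 td; have := dP _ s10 ds1; rewrite !ltr_norml; lra.
  exists d => // t t0 td; rewrite ltr_norml.
  have [ts|/ltW ts] := leP t s.
    by have := osc t s t0 ts td; rewrite subrr normr0 => /(_ d0); lra.
  by have := osc s t s0 ts; rewrite subrr normr0 => /(_ d0 td); lra.
- move=> s t s0 st; apply: running_sup_le => // r /andP[r0 rs].
  by apply: running_sup_ub => //; rewrite r0 (le_trans rs).
- move=> M; have [s s0 Ms] := ua M; exists s => //.
  by apply: lt_le_trans Ms _; apply: running_sup_ub; rewrite ?s0 ?lexx.
Qed.

End ComparisonFunctions.

(** * Bellman recursions, policy improvement and comparison with rollouts *)

Section PolicyIteration.
Context {R : realType} {nx nu : nat}.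
Local Notation X := 'rV[R]_nx.
Local Notation U := 'rV[R]_nu.
Context (f : X -> U -> X) (Uad : X -> set U) (l : X -> U -> R) (g : R).
Hypothesis l_ge0 : forall x u, 0 <= l x u.
Hypothesis g_gt0 : 0 < g.
Implicit Types (x : X) (u w : nat -> U) (h : nat -> X -> U).

Let g_ge0 : 0 <= g := ltW g_gt0.

Definition input_shift u : nat -> U := fun k => u k.+1.

Definition partial_cost n x u : R :=
  \sum_(0 <= k < n) g ^+ k * l (phi f x u k) (u k).

Lemma phi_shift x u k :
  phi f x u k.+1 = phi f (f x (u 0%N)) (input_shift u) k.
Proof. by elim: k => //= k <-. Qed.

Lemma stage_cost_ge0 x u k : 0 <= g ^+ k * l (phi f x u k) (u k).
Proof. by rewrite mulr_ge0// exprn_ge0. Qed.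

Lemma J_ge0 x u : (0 <= J f l g x u)%E.
Proof. by apply: nneseries_ge0 => k _ _; rewrite lee_fin stage_cost_ge0. Qed.

Lemma J_rec x u : J f l g x u =
  ((l x (u 0%N))%:E + g%:E * J f l g (f x (u 0%N)) (input_shift u))%E.
Proof.
rewrite /J nneseries_recl//; last by move=> k _; rewrite lee_fin stage_cost_ge0.
rewrite expr0 mul1r; congr (_ + _)%E.
rewrite -nneseries_addn; last by move=> k; rewrite lee_fin stage_cost_ge0.
rewrite -nneseriesZl; last by move=> k _; rewrite lee_fin stage_cost_ge0.
by apply: eq_eseriesr => k _; rewrite addn1 phi_shift -EFinM exprS mulrA.
Qed.

Lemma partial_cost_rec n x u : partial_cost n.+1 x u =
  l x (u 0%N) + g * partial_cost n (f x (u 0%N)) (input_shift u).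
Proof.
rewrite /partial_cost big_nat_recl//= expr0 mul1r mulr_sumr; congr (_ + _).
by apply: eq_bigr => k _; rewrite -/(phi f x u k.+1) phi_shift exprS mulrA.
Qed.

Lemma partial_cost_ge0 n x u : 0 <= partial_cost n x u.
Proof. by apply: sumr_ge0 => k _; exact: stage_cost_ge0. Qed.

Lemma partial_cost_le_J n x u : ((partial_cost n x u)%:E <= J f l g x u)%E.
Proof.
rewrite /partial_cost -sumEFin; apply: nneseries_lim_ge => k _ _.
by rewrite lee_fin stage_cost_ge0.
Qed.

Lemma policy_inputs_shift (p : X -> U) x :
  input_shift (policy_inputs f p x) = policy_inputs f p (f x (p x)).
Proof. by apply/funext => k; rewrite /input_shift /policy_inputs iterSr. Qed.

Lemma policy_inputs_admissible (p : X -> U) x :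
  admissible_policy Uad p -> admissible_seq f Uad x (policy_inputs f p x).
Proof.
move=> pP k; suff -> : phi f x (policy_inputs f p x) k =
  iter k (fun z => f z (p z)) x by exact: pP.
by elim: k => //= k ->.
Qed.

Lemma Jpol_rec (p : X -> U) x : Jpol f l g x p =
  ((l x (p x))%:E + g%:E * Jpol f l g (f x (p x)) p)%E.
Proof. by rewrite /Jpol J_rec policy_inputs_shift. Qed.

(** Unrolling the inequality [n] times and dropping the nonnegative tail bounds every partial cost
    by [V]; the cost is their limit. *)
Lemma Jpol_le_supersolution (p : X -> U) (V : X -> \bar R) :
  (forall x, 0 <= V x)%E ->
  (forall x, (l x (p x))%:E + g%:E * V (f x (p x)) <= V x)%E ->
  forall x, (Jpol f l g x p <= V x)%E.
Proof.
move=> V0 VP x.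
have SV n : forall y, ((partial_cost n y (policy_inputs f p y))%:E <= V y)%E.
  elim: n => [|n IHn] y; first by rewrite /partial_cost big_nil.
  rewrite partial_cost_rec policy_inputs_shift; apply: le_trans (VP y).
  by rewrite EFinD EFinM leeD2l// lee_wpmul2l.
apply: lime_le.
  by apply: is_cvg_nneseries => k _ _; rewrite lee_fin stage_cost_ge0.
by apply: nearW => n; rewrite sumEFin; exact: SV.
Qed.

Lemma Vpi_ge0 h i x : (0 <= Vpi f l g h i x)%E.
Proof. exact: J_ge0. Qed.

(** Principle of optimality: a cheaper tail, preceded by the first input of [u], would be cheaper
    than [u]. The real stage cost and the factor [g > 0] cancel even if the costs are infinite. *)
Lemma optimal_seq_shift x u : is_optimal_seq f Uad l g x u ->
  is_optimal_seq f Uad l g (f x (u 0%N)) (input_shift u).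
Proof.
move=> [uad umin]; split=> [k|w wad]; first by rewrite -phi_shift; exact: uad.
pose w' k := if k is j.+1 then w j else u 0%N.
have w'ad : admissible_seq f Uad x w'.
  by case=> [|k]; [exact: (uad 0%N) | rewrite phi_shift; exact: wad].
by have := umin _ w'ad; rewrite (J_rec x u) (J_rec x w') /= leeD2lE// lee_pmul2l.
Qed.

Lemma optimal_seq_shiftn x u k : is_optimal_seq f Uad l g x u ->
  is_optimal_seq f Uad l g (phi f x u k) (fun j => u (k + j)%N).
Proof.
elim: k x u => [//|k IHk] x u /optimal_seq_shift /IHk; rewrite -phi_shift.
by congr is_optimal_seq; apply/funext => j.
Qed.

Lemma optimal_seq_le_Vstar x u : is_optimal_seq f Uad l g x u ->
  (J f l g x u <= Vstar f Uad l g x)%E.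
Proof. by move=> [_ umin]; apply: le_ereal_inf_tmp => _ [w /umin ? <-]. Qed.

Section Iteration.
Context (h : nat -> X -> U).
Hypothesis h0_adm : admissible_policy Uad (h 0%N).
Hypothesis h_pi : is_policy_iteration f Uad l g (h 0%N) h.

Local Notation V := (Vpi f l g h).

Lemma policy_greedy i x : Hpi f Uad l g h i x (h i x).
Proof. by case: i => [//|i]; case: h_pi => _; exact. Qed.

Lemma greedy_admissible i x a : Hpi f Uad l g h i x a -> Uad x a.
Proof. by case: i => [|i] /= => [->|[]//]; exact: h0_adm. Qed.

Lemma policy_admissible i : admissible_policy Uad (h i).
Proof. by move=> x; exact: (greedy_admissible (policy_greedy i x)). Qed.

Lemma Vpi_rec i x :
  V i x = ((l x (h i x))%:E + g%:E * V i (f x (h i x)))%E.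
Proof. exact: Jpol_rec. Qed.

(** Policy improvement: [h i] is a competitor in the greedy minimisation, so [V i] is a
    supersolution for the policy [h i.+1]. *)
Lemma Vpi_decreasing i x : (V i.+1 x <= V i x)%E.
Proof.
apply: Jpol_le_supersolution => {}x; first exact: Vpi_ge0.
rewrite [leRHS]Vpi_rec; have [_] := policy_greedy i.+1 x; apply.
exact: policy_admissible.
Qed.

Lemma Vpi_le_initial i x : (V i x <= V 0%N x)%E.
Proof. by elim: i => // i; apply: le_trans; exact: Vpi_decreasing. Qed.

(* Greedy steps do at least as well as following [u] for [i] steps and then
   switching to the initial policy. *)
Lemma greedy_le_rollout i x a u : Hpi f Uad l g h i x a ->
  admissible_seq f Uad x u ->
  ((l x a)%:E + g%:E * V i (f x a) <=
   (partial_cost i x u)%:E + (g ^+ i)%:E * V 0%N (phi f x u i))%E.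
Proof.
elim: i x a u => [|i IHi] x a u.
  move=> -> _; rewrite /partial_cost big_nil expr0 mul1e add0e.
  by rewrite [in leRHS]Vpi_rec.
move=> [_ a_min] uad.
have shift_ad : admissible_seq f Uad (f x (u 0%N)) (input_shift u).
  by move=> k; rewrite -phi_shift; exact: uad.
have step b : ((l x b)%:E + g%:E * V i.+1 (f x b) <=
               (l x b)%:E + g%:E * V i (f x b))%E.
  by rewrite leeD2l// lee_wpmul2l// Vpi_decreasing.
apply: le_trans (step a) _; apply: le_trans (a_min _ (uad 0%N)) _.
(* At the next state the induction hypothesis is used with the selected input, for which its left
   side collapses to [V i] by the Bellman recursion. *)
have := IHi _ _ _ (policy_greedy i (f x (u 0%N))) shift_ad.
rewrite -Vpi_rec -phi_shift partial_cost_rec => H.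
apply: (@le_trans _ _ ((l x (u 0%N))%:E + g%:E *
  ((partial_cost i (f x (u 0%N)) (input_shift u))%:E +
   (g ^+ i)%:E * V 0%N (phi f x u i.+1))))%E.
  by rewrite leeD2l// lee_wpmul2l.
rewrite ge0_muleDr ?mule_ge0 ?lee_fin ?partial_cost_ge0 ?exprn_ge0 ?Vpi_ge0//.
by rewrite addeA muleA -!EFinM -EFinD exprS.
Qed.

End Iteration.

End PolicyIteration.

(** * Regularity of [beta_star] and the comparison principle behind it *)

Section BetaStarTheory.
Context {R : realType} (aVs aWbar aW : R -> R) (gs g : R).
Hypotheses (aVs_Kinf : class_Kinf aVs) (aW_Kinf : class_Kinf aW).
Hypotheses (aWbar_zero : zero_at_zero aWbar)
  (aWbar_cont : continuous_nneg aWbar) (aWbar_nd : nondecreasing_nneg aWbar).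
Hypotheses (gs_gt0 : 0 < gs) (gs_lt_g : gs < g) (g_lt1 : g < 1).

Lemma discount_ratio_gt0 : 0 < (g - gs) / (1 - gs).
Proof. by rewrite divr_gt0 ?subr_gt0// (lt_trans gs_lt_g). Qed.

Lemma class_Kinf_aYsbar : class_Kinf (aYsbar aVs aWbar gs).
Proof.
have gsV : 0 <= gs^-1 by rewrite invr_ge0 ltW.
apply: class_KinfD => //.
- by rewrite /zero_at_zero aWbar_zero mulr0.
- exact: continuous_nnegZ.
- by move=> s t s0 st; rewrite ler_wpM2l// aWbar_nd.
Qed.

Hypothesis aW_le_aYsbar : forall s, 0 <= s -> aW s <= aYsbar aVs aWbar gs s.

Local Notation T :=
  (fun r : R => r - g^-1 * aYs_tilde aVs aWbar aW gs r g).
Local Notation d := (1 - g^-1 * ((g - gs) / (1 - gs))).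

(** Equivalent to [g - gs < g * (1 - gs)], that is, to [g < 1]. A positive slope [d] keeps the
    iterates of [T] nonnegative and unbounded. *)
Lemma contraction_gt0 : 0 < d.
Proof.
have g0 : 0 < g := lt_trans gs_gt0 gs_lt_g.
rewrite subr_gt0 mulrC ltr_pdivrMr// mul1r ltr_pdivrMr; last by rewrite subr_gt0 (lt_trans gs_lt_g).
by rewrite mulrBr mulr1 ltrD2l ltrN2 gtr_pMl.
Qed.

(** With [s] the preimage of [r] under [aYsbar], the bound [aW s <= aYsbar s = r] keeps the
    subtracted term between [0] and [(1 - d) * r]. *)
Lemma iterated_map_bounds r : 0 <= r -> d * r <= T r <= r.
Proof.
move=> r0; have aYsP := class_Kinf_aYsbar.
have inv0 := Kinf_inv_ge0 aYsP r0.
have aW0 := class_Kinf_ge0 aW_Kinf inv0.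
have := aW_le_aYsbar inv0; rewrite Kinf_invKV// => aWr.
have c0 := discount_ratio_gt0.
have gV : 0 < g^-1 by rewrite invr_gt0 (lt_trans gs_gt0).
have k0 := mulr_gt0 gV c0.
by rewrite /aYs_tilde /aYs mulrBl mul1r lerD2l lerN2 gerBl mulrA ler_pM2l//
  aWr mulr_ge0// ltW.
Qed.

Lemma iterated_map_continuous : continuous_nneg T.
Proof.
have invP := class_Kinf_inv class_Kinf_aYsbar.
have -> : T = (fun r => r + (- g^-1 * ((g - gs) / (1 - gs))) *
    (aW \o Kinf_inv (aYsbar aVs aWbar gs)) r).
  by apply/funext => r; rewrite /aYs_tilde /aYs /= mulNr mulNr mulrA.
apply: continuous_nnegD; first exact: continuous_nneg_id.
apply: continuous_nnegZ; apply: continuous_nneg_comp.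
- by case: aW_Kinf.
- by case: invP.
- by move=> s; exact: class_Kinf_ge0.
Qed.

Lemma iter_map_bounds k r : 0 <= r -> d ^+ k * r <= iter k T r <= r.
Proof.
move=> r0; elim: k => [|k /andP[IH1 IH2]]; first by rewrite expr0 mul1r lexx.
have d0 := contraction_gt0.
have it0 : 0 <= iter k T r by rewrite (le_trans _ IH1)// mulr_ge0// exprn_ge0 ?ltW.
have /andP[lo up] := iterated_map_bounds it0.
rewrite iterS (le_trans up)// andbT; apply: le_trans lo.
by rewrite exprS -mulrA ler_pM2l.
Qed.

Lemma iter_map_ge0 k r : 0 <= r -> 0 <= iter k T r.
Proof.
move=> r0; have /andP[+ _] := iter_map_bounds k r0; apply: le_trans.
by rewrite mulr_ge0// exprn_ge0// ltW// contraction_gt0.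
Qed.

Lemma iter_map_continuous k : continuous_nneg (iter k T).
Proof.
elim: k => [|k IHk]; first exact: continuous_nneg_id.
apply: (continuous_nneg_comp iterated_map_continuous IHk) => s.
exact: iter_map_ge0.
Qed.

Lemma iter_map_zero k : zero_at_zero (iter k T).
Proof.
by apply/le_anti; have := iter_map_bounds k (lexx 0); rewrite mulr0 andbC.
Qed.

Lemma beta_tilde_class k :
  nondecreasing_class (beta_tilde aVs aWbar aW gs g ^~ k).
Proof.
apply: running_sup_class; [exact: iter_map_zero|exact: iter_map_continuous|].
move=> M; have dk : 0 < d ^+ k by rewrite exprn_gt0// contraction_gt0.
(* The witness is scaled so that the lower bound [d ^+ k * r] on the iterate equals [|M| + 1]. *)
have s0 : 0 <= (`|M| + 1) / d ^+ k by rewrite divr_ge0 ?ltW// ltr_wpDl.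
exists ((`|M| + 1) / d ^+ k) => //.
have /andP[+ _] := iter_map_bounds k s0; apply: lt_le_trans.
rewrite mulrC divfK ?gt_eqF//; apply: le_lt_trans (ler_norm M) _.
by rewrite ltrDl.
Qed.

Lemma beta_star_class k :
  nondecreasing_class (beta_star aVs aWbar aW gs g ^~ k).
Proof.
apply: (nondecreasing_class_comp (a := Kinf_inv aW)).
  exact/class_Kinf_nondecreasing/class_Kinf_inv.
apply: (nondecreasing_class_comp (beta_tilde_class k)).
exact/class_Kinf_nondecreasing/class_Kinf_aYsbar.
Qed.

(* The iterated map need not be monotone, so the comparison principle goes
   through the intermediate value theorem: [y k] is itself of the form
   [iter k T t] with [t] in [[0, s]]. *)
Lemma beta_tilde_comparison (y : nat -> R) s :
  (forall k, 0 <= y k) -> y 0%N <= s -> (forall k, y k.+1 <= T (y k)) ->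
  forall k, y k <= beta_tilde aVs aWbar aW gs g s k.
Proof.
move=> y0 ys yT k; have s0 := le_trans (y0 0%N) ys.
suff [t tI yt] : exists2 t, 0 <= t <= s & y k <= iter k T t.
  by apply: le_trans yt _; exact: (running_sup_ub (@iter_map_continuous k) tI).
elim: k => [|k [t /andP[t0 ts] yt]]; first by exists s; rewrite ?s0 ?lexx.
have [|t' /andP[t'0 t't] yt'] :=
    continuous_nneg_IVT (@iter_map_continuous k) t0 (y := y k).
  by rewrite iter_map_zero y0.
exists t'; first by rewrite t'0 (le_trans t't).
by rewrite iterS yt'.
Qed.

End BetaStarTheory.

(** * Lyapunov analysis along optimal trajectories *)

Section OptimalTrajectories.
Context {R : realType} {nx nu : nat}.
Local Notation X := 'rV[R]_nx.
Local Notation U := 'rV[R]_nu.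
Context (f : X -> U -> X) (Uad : X -> set U) (l : X -> U -> R) (g : R).
Context (sigma W : X -> R) (aW aWbar aVs : R -> R) (gs : R).
Hypotheses (l_ge0 : forall x u, 0 <= l x u) (sigma_ge0 : forall x, 0 <= sigma x).
Hypotheses (W_ge0 : forall x, 0 <= W x) (aW_Kinf : class_Kinf aW).
Hypotheses (A3_upper : forall x, W x <= aWbar (sigma x))
  (A3_decr : forall x u, Uad x u -> W (f x u) - W x <= - aW (sigma x) + l x u).
Hypotheses (aVs_Kinf : class_Kinf aVs)
  (A5_i : forall x, (Vstar f Uad l g x <= (aVs (sigma x))%:E)%E)
  (A5_ii : forall s, 0 < s -> (1 - gs) * aVs s <= aW s).
Hypotheses (gs_gt0 : 0 < gs) (gs_lt_g : gs < g) (g_lt1 : g < 1).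
Implicit Types (x : X) (u : nat -> U).

Let g_gt0 : 0 < g := lt_trans gs_gt0 gs_lt_g.

Local Notation optimal := (is_optimal_seq f Uad l g).

Lemma optimal_cost_fin x u : optimal x u -> J f l g x u \is a fin_num.
Proof.
move=> uopt; rewrite ge0_fin_numE ?J_ge0//.
apply: le_lt_trans (optimal_seq_le_Vstar uopt) _.
by apply: le_lt_trans (A5_i x) _; rewrite ltry.
Qed.

(** For an optimal [u] this is [V^* + W / g]. Keeping [u] as an argument lets the next state inherit
    the tail of [u], with no new minimiser to choose. *)
Definition lyapunov x u := fine (J f l g x u) + g^-1 * W x.

Lemma optimal_cost_le x u : optimal x u -> fine (J f l g x u) <= aVs (sigma x).
Proof.
move=> uopt; rewrite -lee_fin fineK ?optimal_cost_fin//.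
exact: le_trans (optimal_seq_le_Vstar uopt) (A5_i x).
Qed.

Lemma optimal_cost_rec x u : optimal x u -> fine (J f l g x u) =
  l x (u 0%N) + g * fine (J f l g (f x (u 0%N)) (input_shift u)).
Proof.
move=> uopt; have vopt := optimal_seq_shift l_ge0 g_gt0 uopt.
apply: EFin_inj; rewrite EFinD EFinM !fineK ?optimal_cost_fin//.
exact: J_rec.
Qed.

(** (A5) scaled by [(1 - g) / (1 - gs)], together with [1 - (1 - g) / (1 - gs) = (g - gs) / (1 -
    gs)]. Zero is treated apart because (A5) is stated for positive [s]. *)
Lemma discounted_bound s : 0 <= s ->
  (1 - g) * aVs s - aW s <= - ((g - gs) / (1 - gs) * aW s).
Proof.
rewrite le_eqVlt => /predU1P[<-|s0].
  have [z _ _ _] := aVs_Kinf; have [z' _ _ _] := aW_Kinf.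
  by rewrite z z' !mulr0 subrr oppr0.
have gs1 : 0 < 1 - gs by rewrite subr_gt0 (lt_trans gs_lt_g).
have : (1 - g) / (1 - gs) * ((1 - gs) * aVs s) <= (1 - g) / (1 - gs) * aW s.
  by rewrite ler_wpM2l ?A5_ii// divr_ge0// ltW// subr_gt0.
rewrite mulrA divfK ?gt_eqF// => H.
have -> : (g - gs) / (1 - gs) = 1 - (1 - g) / (1 - gs).
  by apply: (mulIf (lt0r_neq0 gs1)); rewrite divfK ?gt_eqF// mulrBl divfK ?gt_eqF//; lra.
by rewrite [(1 - _ / _) * _]mulrBl mul1r opprB lerD2r.
Qed.

(** Drops [W (f x a) >= 0] from (A3) and uses [1 <= g^-1]. Since one stage cost suffices, this
    yields the lower Lyapunov bound for optimal and iterated policies alike. *)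
Lemma dissipation x a : Uad x a -> 0 <= aW (sigma x) <= l x a + g^-1 * W x.
Proof.
move=> uad; rewrite class_Kinf_ge0//=.
have := A3_decr uad; rewrite lerBlDr => WP.
have Wg : W x <= g^-1 * W x.
  by rewrite ler_peMl// invf_ge1// ltW.
by have := W_ge0 (f x a); lra.
Qed.

Lemma lyapunov_bounds x u : optimal x u ->
  aW (sigma x) <= lyapunov x u <= aYsbar aVs aWbar gs (sigma x).
Proof.
move=> uopt; apply/andP; split; last first.
  apply: lerD; first exact: optimal_cost_le.
  (* Replacing [g^-1] by the larger [gs^-1] makes the upper bound uniform in [g]. *)
  rewrite ler_pM ?invr_ge0 ?(ltW g_gt0)// lef_pV2 ?posrE//.
  exact: ltW.
have uad : Uad x (u 0%N) by case: uopt => /(_ 0%N).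
have /andP[_ H] := dissipation uad; apply: le_trans H _.
rewrite lerD2r optimal_cost_rec// lerDl mulr_ge0 ?(ltW g_gt0)//.
by rewrite fine_ge0// J_ge0.
Qed.

(** After multiplication by [g], the cost recursion contributes [(1 - g) V^* - l] and (A3)
    contributes [- aW + l]; the stage costs cancel and [discounted_bound] absorbs [(1 - g) V^*]. *)
Lemma lyapunov_decr x u : optimal x u ->
  lyapunov (f x (u 0%N)) (input_shift u) - lyapunov x u <=
  - (g^-1 * ((g - gs) / (1 - gs) * aW (sigma x))).
Proof.
move=> uopt; have uad : Uad x (u 0%N) by case: uopt => /(_ 0%N).
have := A3_decr uad; have := discounted_bound (sigma_ge0 x).
have := optimal_cost_le uopt; have := optimal_cost_rec uopt.
rewrite /lyapunov; set a := fine _; set b := fine _ => ab aVsP dP WP.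
rewrite -mulrN -(ler_pM2l g_gt0) mulrBr !mulrDr !mulrA mulfV ?gt_eqF// !mul1r.
apply: le_trans dP.
have := ler_wpM2l (_ : 0 <= 1 - g) aVsP; rewrite subr_ge0 => /(_ (ltW g_lt1)).
by lra.
Qed.

Definition lyapunov_along x u k :=
  lyapunov (phi f x u k) (fun j => u (k + j)%N).

Lemma lyapunov_along_decr x u k : optimal x u ->
  lyapunov_along x u k.+1 - lyapunov_along x u k <=
  - (g^-1 * ((g - gs) / (1 - gs) * aW (sigma (phi f x u k)))).
Proof.
move=> uopt; have := lyapunov_decr (optimal_seq_shiftn l_ge0 g_gt0 k uopt).
rewrite addn0; congr (_ - _ <= _); congr lyapunov.
by apply/funext => j; rewrite /input_shift addnS.
Qed.

Lemma sigma_le_beta_star x u k :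
  (forall s, 0 <= s -> aW s <= aYsbar aVs aWbar gs s) ->
  zero_at_zero aWbar -> continuous_nneg aWbar -> nondecreasing_nneg aWbar ->
  optimal x u ->
  sigma (phi f x u k) <= beta_star aVs aWbar aW gs g (sigma x) k.
Proof.
move=> aW_le z c n uopt.
have aYsP := class_Kinf_aYsbar aVs_Kinf z c n gs_gt0.
have opt j := optimal_seq_shiftn l_ge0 g_gt0 j uopt.
have y0 j : 0 <= lyapunov_along x u j.
  have /andP[+ _] := lyapunov_bounds (opt j); apply: le_trans.
  exact: class_Kinf_ge0.
have -> : sigma (phi f x u k) = Kinf_inv aW (aW (sigma (phi f x u k))).
  by rewrite Kinf_invK.
apply: (class_Kinf_le (class_Kinf_inv aW_Kinf)); first exact: class_Kinf_ge0.
have /andP[+ _] := lyapunov_bounds (opt k); move/le_trans; apply.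
apply: (beta_tilde_comparison aVs_Kinf aW_Kinf z c n gs_gt0 gs_lt_g g_lt1 aW_le
  y0).
  by have /andP[] := lyapunov_bounds uopt.
(* The upper Lyapunov bound gives [sigma >= Kinf_inv aYsbar y], which turns the decrease in terms of
   [sigma] into [y j.+1 <= T (y j)]. *)
move=> j; have := lyapunov_along_decr j uopt.
rewrite lerBlDl => /le_trans; apply; rewrite lerD2l lerN2.
rewrite ler_pM2l ?invr_gt0// ler_pM2l; last first.
  exact: (discount_ratio_gt0 gs_lt_g g_lt1).
apply: (class_Kinf_le aW_Kinf); first exact: Kinf_inv_ge0.
rewrite -[leRHS](Kinf_invK aYsP)//.
apply: (class_Kinf_le (class_Kinf_inv aYsP)) => //.
by have /andP[] := lyapunov_bounds (opt j).
Qed.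

(* Otherwise the Lyapunov function would decrease forever by a fixed amount. *)
Lemma sigma_small x u e : optimal x u -> 0 < e -> exists y, sigma y < e.
Proof.
move=> uopt e0; apply: contrapT => /forallNP far.
have {}far y : e <= sigma y by rewrite leNgt; apply/negP.
pose dlt := g^-1 * ((g - gs) / (1 - gs) * aW e).
have aWe : 0 < aW e by have [z _ inc _] := aW_Kinf; rewrite -[ltLHS]z inc.
have c0 := discount_ratio_gt0 gs_lt_g g_lt1.
have dlt0 : 0 < dlt by rewrite mulr_gt0 ?invr_gt0// mulr_gt0.
have bound k : lyapunov_along x u k <= lyapunov_along x u 0 - k%:R * dlt.
  elim: k => [|k IHk]; first by rewrite mul0r subr0.
  have := lyapunov_along_decr k uopt; rewrite lerBlDl => /le_trans; apply.
  rewrite -natr1 [(_ + 1) * _]mulrDl mul1r opprD addrA lerD// lerN2.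
  rewrite ler_pM2l ?invr_gt0// ler_pM2l//.
  by apply: class_Kinf_le => //; exact: ltW.
(* After [n] steps the total decrease [n * dlt] exceeds the initial value, against nonnegativity. *)
pose n := Num.bound `|lyapunov_along x u 0 / dlt|.
have /andP[+ _] := lyapunov_bounds (optimal_seq_shiftn l_ge0 g_gt0 n uopt).
have := class_Kinf_ge0 aW_Kinf (sigma_ge0 (phi f x u n)).
move=> /le_trans /[apply] /le_trans /(_ (bound n)).
rewrite subr_ge0 leNgt -ltr_pdivrMr//.
suff -> : lyapunov_along x u 0 / dlt < n%:R by [].
by apply: le_lt_trans (ler_norm _) _; apply: archi_boundP.
Qed.

End OptimalTrajectories.

(** * The values taken by the state measure *)

Section RadiallyUnbounded.
Context {R : realType} {n : nat} (sigma : 'rV[R]_n -> R).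
Hypotheses (n_gt0 : (0 < n)%N) (sigma_cont : continuous sigma).
Hypothesis sigma_radial : forall D, 0 < D -> compact [set x | sigma x <= D].

(** Otherwise some sublevel set would be the whole space, which is unbounded in positive dimension
    and so not compact. *)
Lemma radial_large s : exists x, s < sigma x.
Proof.
apply: contrapT => /forallNP small.
have D0 : 0 < `|s| + 1 by rewrite ltr_wpDl.
have /compact_bounded[M [_ MP]] := sigma_radial D0.
pose v : 'rV[R]_n := const_mx 1.
have v0 : 0 < `|v|.
  rewrite normr_gt0; apply/eqP => /rowP /(_ (Ordinal n_gt0)).
  by rewrite !mxE => /eqP; rewrite oner_eq0.
have := MP (`|M| + 1) (le_lt_trans (ler_norm M) (ltr_pwDr ltr01 (lexx _)))
  (((`|M| + 2) / `|v|) *: v).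
rewrite /= normrZ ger0_norm ?divr_ge0 ?addr_ge0// divfK ?gt_eqF// => H.
have : sigma (((`|M| + 2) / `|v|) *: v) <= `|s| + 1.
  have := small (((`|M| + 2) / `|v|) *: v) => /negP; rewrite -leNgt.
  by move=> /le_trans; apply; rewrite (le_trans (ler_norm s))// lerDl.
by move=> /H; rewrite lerD2l; lra.
Qed.

(** Intermediate value theorem on the segment from [x] to a point of measure above [s]. *)
Lemma radial_surj s x : sigma x <= s -> exists y, sigma y = s.
Proof.
move=> xs; have [z /ltW sz] := radial_large s.
pose p t := sigma (x + t *: (z - x)).
have cp : continuous p.
  move=> t; apply: continuous_comp; last exact: sigma_cont.
  by apply: cvgD; [exact: cvg_cst | exact: scalel_continuous].
have [||t _ pt] := IVT (f := p) (a := 0) (b := 1) (v := s) ler01.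
- exact: continuous_subspaceT.
- rewrite /p scale0r addr0 scale1r addrC subrK.
  by rewrite ge_min le_max xs sz orbT.
- by exists (x + t *: (z - x)).
Qed.

End RadiallyUnbounded.

(** * Dissipation inequalities for the iterated value functions *)

Theorem theorem2 (R : realType) (nx nu : nat)
  (nx_gt0 : (0 < nx)%N) (nu_gt0 : (0 < nu)%N)
  (* system, admissible inputs, stage cost, state measure *)
  (f : 'rV[R]_nx -> 'rV[R]_nu -> 'rV[R]_nx)
  (Uad : 'rV[R]_nx -> set 'rV[R]_nu)
  (Uad_neq0 : forall x, Uad x !=set0)
  (l : 'rV[R]_nx -> 'rV[R]_nu -> R)
  (l_ge0 : forall x u, 0 <= l x u)
  (sigma : 'rV[R]_nx -> R)
  (sigma_ge0 : forall x, 0 <= sigma x)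
  (sigma_cont : continuous sigma)
  (sigma_radial : forall D, 0 < D -> compact [set x | sigma x <= D])
  (* (A1) *)
  (A1 : forall x g, 0 < g < 1 ->
    (exists u, is_optimal_seq f Uad l g x u) /\ (Vstar f Uad l g x < +oo)%E)
  (* (A3) *)
  (W : 'rV[R]_nx -> R) (aW aWbar : R -> R)
  (W_ge0 : forall x, 0 <= W x)
  (W_cont : continuous W)
  (aW_Kinf : class_Kinf aW)
  (aWbar_zero : zero_at_zero aWbar)
  (aWbar_cont : continuous_nneg aWbar)
  (aWbar_nd : nondecreasing_nneg aWbar)
  (A3_upper : forall x, W x <= aWbar (sigma x))
  (A3_decr : forall x u, Uad x u ->
    W (f x u) - W x <= - aW (sigma x) + l x u)
  (* (A4) *)
  (h0 : 'rV[R]_nx -> 'rV[R]_nu)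
  (h0_adm : admissible_policy Uad h0)
  (g0 : R) (g0_itv : 0 < g0 <= 1)
  (aV : R -> R -> R)
  (aV_Kinf : forall g, 0 < g < g0 -> class_Kinf (aV ^~ g))
  (A4 : forall x g, 0 < g < g0 -> (Jpol f l g x h0 <= (aV (sigma x) g)%:E)%E)
  (* (A5) *)
  (aVs : R -> R)
  (aVs_Kinf : class_Kinf aVs)
  (A5_i : forall x g, 0 < g < g0 ->
    (Vstar f Uad l g x <= (aVs (sigma x))%:E)%E)
  (gs : R) (gs_itv : 0 < gs < g0)
  (A5_ii : forall s, 0 < s -> (1 - gs) * aVs s <= aW s)
  (* policy iteration, with arbitrary selections, and (A2) *)
  (h : R -> nat -> 'rV[R]_nx -> 'rV[R]_nu)
  (h_pi : forall g, gs < g < g0 -> is_policy_iteration f Uad l g h0 (h g))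
  (A2 : forall g i x, gs < g < g0 -> (0 < i)%N ->
    Hpi f Uad l g (h g) i x !=set0) :
  exists (aYlow : R -> R) (aYbar aY : R -> R -> R),
    [/\ class_Kinf aYlow,
        (forall g, gs < g < g0 -> class_Kinf (aYbar ^~ g)) &
        (forall g, gs < g < g0 -> class_Kinf (aY ^~ g))] /\
    [/\ (forall s, 0 <= s -> aYlow s = aW s),
        (forall s g, 0 <= s -> gs < g < g0 ->
           aYbar s g = aV s g + g^-1 * aWbar s) &
        (forall s g, 0 <= s -> gs < g < g0 ->
           aY s g = (g - gs) / (1 - gs) * aW s)] /\
    forall i : nat,
      exists (Y : R -> 'rV[R]_nx -> R) (Ups : R -> R -> R),
        [/\ (forall g x, gs < g < g0 -> 0 <= Y g x),
            (forall g x, gs < g < g0 ->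
               (Y g x)%:E = (Vpi f l g (h g) i x + (g^-1 * W x)%:E)%E),
            (forall g, gs < g < g0 -> class_Kinf (Ups ^~ g)) &
            (forall s g, 0 <= s -> gs < g < g0 ->
               Upsilon_star aVs aWbar aW gs aV i s g <= Ups s g)] /\
        forall g, gs < g < g0 ->
          [/\ (* (i) *)
              (forall x, aYlow (sigma x) <= Y g x <= aYbar (sigma x) g),
              (* (ii) *)
              (forall x v, Fpi f Uad l g (h g) i x v ->
                 Y g v - Y g x <= g^-1 * (- aY (sigma x) g + Ups (sigma x) g)),
              (* regularity of the explicit expression of Upsilon *)
              [/\ zero_at_zero (Upsilon_star aVs aWbar aW gs aV i ^~ g),
                  continuous_nneg (Upsilon_star aVs aWbar aW gs aV i ^~ g),
                  nondecreasing_nneg (Upsilon_star aVs aWbar aW gs aV i ^~ g) &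
                  unbounded_nneg (Upsilon_star aVs aWbar aW gs aV i ^~ g)] &
              (* (ii) with the explicit expression of Upsilon *)
              (forall x, Y g (f x (h g i x)) - Y g x <=
                 g^-1 * (- aY (sigma x) g +
                         Upsilon_star aVs aWbar aW gs aV i (sigma x) g))].
Proof.
have gP g : gs < g < g0 -> [/\ 0 < g, g < 1, 0 < g < g0 & gs < g].
  case/andP: gs_itv => gs0 _; case/andP: g0_itv => _ g01 /andP[gsg gg0].
  have g_pos := lt_trans gs0 gsg.
  by split=> //; [exact: lt_le_trans g01 | rewrite g_pos].
have /andP[gs_gt0 gs_lt_g0] := gs_itv.
have optP g x : gs < g < g0 -> exists u, is_optimal_seq f Uad l g x u.
  by move=> /gP[gpos g1 _ _]; have [|+ _] := A1 x g; rewrite ?gpos.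
have aW_le s : 0 <= s -> aW s <= aYsbar aVs aWbar gs s.
  have aYsP := class_Kinf_aYsbar aVs_Kinf aWbar_zero aWbar_cont aWbar_nd gs_gt0.
  rewrite le_eqVlt => /predU1P[<-|s0].
    by have [-> _ _ _] := aW_Kinf; exact: class_Kinf_ge0.
  (* The claim does not involve [g]; the midpoint just supplies one discount factor for which
     optimal trajectories can be used. *)
  pose g := (gs + g0) / 2.
  have gI : gs < g < g0 by rewrite midf_lt//= midf_lt.
  have [g_pos g1 gI0 gsg] := gP _ gI.
  have [u uopt] := optP g 0 gI.
  have A5 x := A5_i x g gI0.
  have [y /ltW ys] := sigma_small l_ge0 sigma_ge0 W_ge0 aW_Kinf A3_upper A3_decr
    aVs_Kinf A5 A5_ii gs_gt0 gsg g1 uopt s0.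
  have [z <-] := radial_surj nx_gt0 sigma_cont sigma_radial ys.
  have [w wopt] := optP g z gI.
  have /andP[] := lyapunov_bounds l_ge0 sigma_ge0 W_ge0 aW_Kinf A3_upper A3_decr
    A5 gs_gt0 gsg g1 wopt.
  exact: le_trans.
have pi0 g : gs < g < g0 ->
    admissible_policy Uad (h g 0%N) /\
    is_policy_iteration f Uad l g (h g 0%N) (h g).
  by move=> /h_pi[h00 hS]; rewrite -[0%N]/(0 : nat) h00.
have V_ge0 g i x : gs < g < g0 -> (0 <= Vpi f l g (h g) i x)%E.
  by move=> /gP[g_pos _ _ _]; exact: Vpi_ge0.
have V_le g i x : gs < g < g0 -> (Vpi f l g (h g) i x <= (aV (sigma x) g)%:E)%E.
  move=> gI; have [g_pos _ gI0 _] := gP _ gI; have [ad0 piP] := pi0 _ gI.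
  apply: le_trans (Vpi_le_initial l_ge0 g_pos ad0 piP i x) _.
  by rewrite /Vpi; have [-> _] := h_pi _ gI; exact: A4.
have V_fin g i x : gs < g < g0 -> Vpi f l g (h g) i x \is a fin_num.
  move=> gI; rewrite ge0_fin_numE ?V_ge0//.
  by apply: le_lt_trans (V_le g i x gI) _; rewrite ltry.
have beta_class g i (gI : gs < g < g0) :
    nondecreasing_class (beta_star aVs aWbar aW gs g ^~ i).
  have [_ g1 _ gsg] := gP _ gI.
  exact: (beta_star_class aVs_Kinf aW_Kinf aWbar_zero aWbar_cont aWbar_nd
    gs_gt0 gsg g1 aW_le).
have aVbeta_class g i (gI : gs < g < g0) :
    nondecreasing_class (fun s => aV (beta_star aVs aWbar aW gs g s i) g).
  have [_ _ gI0 _] := gP _ gI.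
  apply: (nondecreasing_class_comp (a := aV ^~ g) _ (beta_class g i gI)).
  exact: class_Kinf_nondecreasing (aV_Kinf _ gI0).
(* Here [vs] is [V^*] at [x]: the rollout follows an optimal [u], whose partial cost is at most
   [vs]. *)
have greedy_le g i x a (gI : gs < g < g0) : Hpi f Uad l g (h g) i x a ->
    exists2 vs, vs <= aVs (sigma x) /\ vs <= fine (Vpi f l g (h g) i x) &
    l x a + g * fine (Vpi f l g (h g) i (f x a)) <=
    vs + g ^+ i * aV (beta_star aVs aWbar aW gs g (sigma x) i) g.
  move=> aH; have [g_pos g1 gI0 gsg] := gP _ gI; have [ad0 piP] := pi0 _ gI.
  have A5 y := A5_i y g gI0.
  have [u uopt] := optP g x gI.
  have J_fin := optimal_cost_fin l_ge0 A5 gs_gt0 gsg uopt.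
  exists (fine (J f l g x u)).
    split; first exact: (optimal_cost_le l_ge0 A5 gs_gt0 gsg uopt).
    apply: fine_le; rewrite ?V_fin//.
    apply: uopt.2; apply: policy_inputs_admissible.
    exact: (policy_admissible ad0 piP).
  have [uad _] := uopt.
  rewrite -lee_fin EFinD EFinM fineK ?V_fin//.
  apply: le_trans (greedy_le_rollout l_ge0 g_pos ad0 piP aH uad) _.
  rewrite EFinD EFinM fineK//; apply: leeD; first exact: partial_cost_le_J.
  apply: lee_wpmul2l; first by rewrite lee_fin exprn_ge0// ltW.
  apply: le_trans (V_le g 0%N _ gI) _; rewrite lee_fin.
  apply: (class_Kinf_le (aV_Kinf _ gI0)) => //.
  exact: (sigma_le_beta_star l_ge0 sigma_ge0 W_ge0 aW_Kinf A3_upper A3_decr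
    aVs_Kinf A5 A5_ii gs_gt0 gsg g1 i aW_le).
have decr g x vs y (gI : gs < g < g0) : vs <= aVs (sigma x) ->
  (1 - g) * vs - aW (sigma x) + y <= - ((g - gs) / (1 - gs) * aW (sigma x)) + y.
  move=> vsP; have [_ g1 _ gsg] := gP _ gI; rewrite lerD2r.
  apply: le_trans (discounted_bound aW_Kinf aVs_Kinf A5_ii gsg g1 (sigma_ge0 x)).
  by rewrite lerD2r ler_wpM2l// subr_ge0 ltW.
exists aW, (fun s g => aV s g + g^-1 * aWbar s),
  (fun s g => (g - gs) / (1 - gs) * aW s); split; [|split].
- split=> // g /gP[g_pos g1 gI0 gsg].
    have gV : 0 <= g^-1 by rewrite invr_ge0 ltW.
    apply: (class_KinfD (aV_Kinf _ gI0)).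
    + by rewrite /zero_at_zero aWbar_zero mulr0.
    + exact: continuous_nnegZ.
    + by move=> s t s0 st; rewrite ler_wpM2l// aWbar_nd.
  apply: class_KinfZ => //; exact: discount_ratio_gt0.
- by split.
(* The summand [s] makes [Ups] strictly increasing despite the plateaus of [beta_star]. *)
move=> i; exists (fun g x => fine (Vpi f l g (h g) i x) + g^-1 * W x),
  (fun s g => g ^+ i * aV (beta_star aVs aWbar aW gs g s i) g + s); split.
- split.
  + move=> g x gI; have [g_pos _ _ _] := gP _ gI.
    by rewrite addr_ge0 ?fine_ge0 ?V_ge0// mulr_ge0// invr_ge0 ltW.
  + by move=> g x gI; rewrite EFinD fineK ?V_fin.
  + move=> g gI; have [g_pos _ _ _] := gP _ gI.
    have [z c n _] := nondecreasing_classZ (exprn_gt0 i g_pos) (aVbeta_class g i gI).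
    have := class_KinfD class_Kinf_id z c n.
    by congr class_Kinf; apply/funext => s; rewrite addrC.
  + move=> s g s0 gI; have [g_pos _ _ _] := gP _ gI.
    rewrite /Upsilon_star -mulrA.
    have B : 0 <= g ^+ i * aV (beta_star aVs aWbar aW gs g s i) g.
      rewrite mulr_ge0 ?exprn_ge0 ?(ltW g_pos)//.
      exact: (nondecreasing_class_ge0 (aVbeta_class g i gI)).
    rewrite mulrBl mul1r lerD2l; apply: le_trans s0.
    by rewrite oppr_le0 mulr_ge0// ltW.
move=> g gI; have [g_pos g1 gI0 gsg] := gP _ gI; have [ad0 piP] := pi0 _ gI.
pose V x := fine (Vpi f l g (h g) i x).
pose Ups s := g ^+ i * aV (beta_star aVs aWbar aW gs g s i) g.
have V_rec x : V x = l x (h g i x) + g * V (f x (h g i x)).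
  by apply: EFin_inj; rewrite EFinD EFinM !fineK ?V_fin// -Vpi_rec.
have scale p q r s z : g * p + q - g * r - s <= z ->
    (p + g^-1 * q) - (r + g^-1 * s) <= g^-1 * z.
  move=> H; rewrite ler_pdivlMl// mulrBr !mulrDr !mulVKf ?gt_eqF//.
  by rewrite opprD addrA.
split.
- move=> x; apply/andP; split.
    have ad : Uad x (h g i x) by exact: (policy_admissible ad0 piP).
    have /andP[_ H] := dissipation sigma_ge0 W_ge0 aW_Kinf A3_decr gs_gt0 gsg g1 ad.
    apply: le_trans H _; rewrite lerD2r -/(V x) V_rec lerDl.
    by rewrite mulr_ge0 ?(ltW g_pos)// fine_ge0// V_ge0.
  apply: lerD; first by rewrite -lee_fin fineK ?V_fin// V_le.
  by rewrite ler_wpM2l// invr_ge0 ltW.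
(* For an arbitrary greedy input, [g * V v] is bounded by [vs - l x a + Ups (sigma x)], and
   [- g * V x] by [- g * vs]. Together they leave [(1 - g) * vs] with the full [Ups (sigma x)]. *)
- move=> x v [a aH <-]; apply: scale.
  have [vs [vs_le vsV] H] := greedy_le g i x a gI aH.
  have := A3_decr _ _ (greedy_admissible ad0 aH).
  have := decr g x vs (Ups (sigma x)) gI vs_le.
  have := ler_wpM2l (ltW g_pos) vsV; have := sigma_ge0 x.
  by rewrite -/(V _) -/(V _) -/(Ups _) in H *; lra.
- have [g1' gi] : 0 < 1 - g /\ 0 < g ^+ i by rewrite subr_gt0 exprn_gt0.
  exact: (nondecreasing_classZ (mulr_gt0 g1' gi) (aVbeta_class g i gI)).
(* For the selected input, [g * V (f x a) = V x - l x a] exactly, so the cost increment is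
   [(1 - g) * V x - l x a]. Bounding [V x] by [vs + Ups (sigma x)] then keeps the factor [1 - g] on
   both terms. *)
- move=> x; apply: scale; set a := h g i x.
  have aH : Hpi f Uad l g (h g) i x a by exact: policy_greedy piP i x.
  have [vs [vs_le _] H] := greedy_le g i x a gI aH.
  have := A3_decr _ _ (greedy_admissible ad0 aH).
  have := decr g x vs ((1 - g) * Ups (sigma x)) gI vs_le.
  rewrite -/(V _) -V_rec -/(Ups _) in H.
  have := ler_wpM2l (_ : 0 <= 1 - g) H; rewrite subr_ge0 => /(_ (ltW g1)).
  have -> : Upsilon_star aVs aWbar aW gs aV i (sigma x) g =
    (1 - g) * Ups (sigma x) by rewrite /Ups mulrA.
  rewrite -/(V _) -/(V _).
  have := V_rec x; rewrite -/a.
  by lra.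
Qed.
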